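(* If $\mathfrak{b}<\mathfrak{b}(\mathcal{J},\mathrm{Fin},\mathrm{Fin})$ for some ideal $\mathcal{J}$ on $\omega$, then there is an ideal $\mathcal{I}$, which is not a weak P-ideal, such that $\mathfrak{b}(\mathcal{I},\mathcal{I},\mathcal{I})=\mathfrak{b}<\mathfrak{b}(\mathcal{I},\mathrm{Fin},\mathrm{Fin})$.
   Context: An ideal on a countable infinite set $X$ is a family $\mathcal{I}\subseteq\mathcal{P}(X)$ closed under finite unions and subsets, containing all finite subsets, with $X\notin\mathcal{I}$; $\mathrm{Fin}$ denotes the ideal of finite subsets of the relevant set. $\mathcal{I}$ is a weak P-ideal if for every countable $\mathcal{A}\subseteq\mathcal{I}$ there is $B\notin\mathcal{I}$ with $A\cap B$ finite for all $A\in\mathcal{A}$. $\mathfrak{b}$ is the bounding number. For an ideal $\mathcal{K}$ on $X$, $\widehat{\mathcal{P}}_{\mathcal{K}}$ is the family of sequences $\langle A_n:n\in\omega\rangle$ of pairwise disjoint members of $\mathcal{K}$, and $\mathcal{P}_{\mathcal{K}}$ those with union $X$. For ideals on $X$: $\mathfrak{b}(\mathcal{I},\mathcal{J},\mathcal{K})=\min\{|\mathcal{E}|:\mathcal{E}\subseteq\widehat{\mathcal{P}}_{\mathcal{K}},\ \forall\langle A_n\rangle\in\mathcal{P}_{\mathcal{J}}\ \exists\langle E_n\rangle\in\mathcal{E}\ \bigcup_n(A_n\cap\bigcup_{i\le n}E_i)\notin\mathcal{I}\}$, with $\min\emptyset=\mathfrak{c}^+$. *)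

(* Defs.v *)
From HB Require Import structures.
From mathcomp Require Import all_boot.
From mathcomp Require Import boolp classical_sets functions cardinality.

Set Implicit Arguments.
Unset Strict Implicit.
Unset Printing Implicit Defensive.

Local Open Scope classical_set_scope.
Local Open Scope card_scope.

(* A cardinal is given by a set of that cardinality, on an arbitrary type;
   equality of cardinals is therefore [eqc], not Leibniz equality. *)
Record cardinal := Card { card_type : Type; card_rep : set card_type }.
Arguments card_rep : clear implicits.

Definition eqc (k l : cardinal) : bool := card_rep k #= card_rep l.
Definition lec (k l : cardinal) : bool := card_rep k #<= card_rep l.
Definition ltc (k l : cardinal) : bool := lec k l && ~~ eqc k l.

Declare Scope cardinal_scope.
Delimit Scope cardinal_scope with cardinal.
Bind Scope cardinal_scope with cardinal.
Notation "k =c l" := (eqc k l) (at level 70) : cardinal_scope.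
Notation "k <=c l" := (lec k l) (at level 70) : cardinal_scope.
Notation "k <c l" := (ltc k l) (at level 70) : cardinal_scope.

Definition of_min_card T (F : set (set T)) (E : set T) :=
  F E /\ forall E', F E' -> E #<= E'.

(* min {|E| : E in F}; only meaningful when F is nonempty (of_min_cardP). *)
Definition min_card T (F : set (set T)) : cardinal :=
  Card (xget set0 (of_min_card F)).

(* The successor |A|^+. Since |A|^+ <= 2^|A| <= 2^|T|, it is enough to look for it
   among the cardinalities of families of subsets of T (succ_cardP). *)
Definition succ_card T (A : set T) : cardinal :=
  min_card [set B : set (set T) | (Card A <c Card B)%cardinal].

Definition continuum_succ : cardinal := succ_card [set: set nat].

Definition eventually_le (f g : nat -> nat) :=
  exists N, forall n, N <= n -> f n <= g n.

Definition unbounded (F : set (nat -> nat)) :=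
  ~ exists g, forall f, F f -> eventually_le f g.

Definition bounding_number : cardinal := min_card unbounded.

Section Ideals.
Variable X : Type.
Implicit Types I J K : set (set X).

Record ideal I : Prop := Ideal {
  ideal_carrier : [set: X] #= [set: nat];
  ideal_setU : forall A B, I A -> I B -> I (A `|` B);
  ideal_subset : forall A B, A `<=` B -> I B -> I A;
  ideal_finite : forall A, finite_set A -> I A;
  ideal_setT : ~ I [set: X] }.

Definition Fin : set (set X) := [set A | finite_set A].

Definition weak_P_ideal I :=
  forall C : set (set X), countable C -> C `<=` I ->
    exists2 B, ~ I B & forall A, C A -> finite_set (A `&` B).

Definition Phat K : set (nat -> set X) :=
  [set A | (forall n, K (A n)) /\ trivIset setT A].

Definition Ppart K : set (nat -> set X) :=
  [set A | Phat K A /\ \bigcup_n A n = setT].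

Definition b_witness I J K : set (set (nat -> set X)) :=
  [set F | F `<=` Phat K /\
    forall A, Ppart J A -> exists2 E, F E &
      ~ I (\bigcup_n (A n `&` \bigcup_(i in [set i | i <= n]) E i))].

Definition b_ideal I J K : cardinal :=
  if `[< b_witness I J K !=set0 >] then min_card (b_witness I J K)
  else continuum_succ.

End Ideals.

Arguments Fin {X}.

Section CardinalFacts.

Lemma min_index (I : Type) (i0 : I) (T : I -> Type) (A : forall i, set (T i)) :
  exists i, forall j, A i #<= A j.
Proof.
pose P : set (set (forall i, T i)) :=
  [set D | forall i, (forall g, D g -> A i (g i)) /\
           (forall g h, D g -> D h -> g i = h i -> g = h)].
have [|D [PD maxD]] := @Zorn_bigcup _ P.
  move=> F FP Ftot i; split => [g [D FD Dg]|g h [D FD Dg] [D' FD' D'h] gh].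
    by have [+ _] := FP _ FD i; apply.
  have [DD'|D'D] := Ftot _ _ FD FD'.
    by have [_ +] := FP _ FD' i; apply => //; exact: DD'.
  by have [_ +] := FP _ FD i; apply => //; exact: D'D.
have [[i Ai]|noi] := pselect (exists i, forall x, A i x -> exists2 g, D g & g i = x).
  exists i => j.
  have inj k : {in D &, injective (fun g : forall i, T i => g k)}.
    by move=> g h /set_mem Dg /set_mem Dh; have [_ +] := PD k; apply.
  have eqA : A i = (fun g : forall i, T i => g i) @` D.
    apply/seteqP; split => [x /Ai[g Dg <-]|_ [g Dg <-]]; first by exists g.
    by have [+ _] := PD i; apply.
  rewrite eqA (card_le_eql (inj_card_eq (inj i))).
  rewrite -(card_le_eql (inj_card_eq (inj j))).
  by apply: subset_card_le => _ [g Dg <-]; have [+ _] := PD j; apply.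
have ex (i : I) : exists x, A i x /\ forall h, D h -> h i <> x.
  apply: contrapT => nx; apply: noi; exists i => x Aix; apply: contrapT => ng.
  by apply: nx; exists x; split=> // h Dh hx; apply: ng; exists h.
pose g i := sval (cid (ex i)).
have gP i : A i (g i) /\ forall h, D h -> h i <> g i by exact: svalP (cid (ex i)).
have /maxD[] : D `<` D `|` [set g].
  split; first by move=> h; left.
  by move=> /(_ g (or_intror erefl))/(proj2 (gP i0)); apply.
move=> i; split=> [h [|->]|h k [Dh|->] [Dk|->]] //.
- by have [+ _] := PD i; apply.
- by case: (gP i).
- by have [_ +] := PD i; apply.
- by move/(proj2 (gP i) h Dh).
- by move/esym/(proj2 (gP i) k Dk).
Qed.

Lemma of_min_cardP T (F : set (set T)) :
  F !=set0 -> of_min_card F (card_rep (min_card F)).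
Proof.
move=> [E0 FE0]; apply: xgetPex.
have [[E FE] minE] := @min_index {E | F E} (exist _ E0 FE0) (fun=> T) (fun E => sval E).
by exists E; split=> // E' FE'; exact: (minE (exist _ E' FE')).
Qed.

Lemma card_le_total T U (A : set T) (B : set U) : A #<= B \/ B #<= A.
Proof.
pose S b : Type := if b then T else U.
pose C b : set (S b) := if b return set (S b) then A else B.
by have [[] /= CP] := @min_index bool true S C;
  [left; exact: (CP false)|right; exact: (CP true)].
Qed.

Lemma ltcNge (k l : cardinal) : (k <c l)%cardinal <-> ~ (l <=c k)%cardinal.
Proof.
case: k l => [T A] [U B]; rewrite /ltc /lec /eqc /=; split.
  by move=> /andP[AB] /negP nAB BA; apply: nAB; rewrite card_eq_le AB BA.
move=> nBA; have [AB|//] := card_le_total A B; rewrite AB /=.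
by apply/negP; rewrite card_eq_le => /andP[_].
Qed.

Lemma cantor T (A : set T) : (Card A <c Card [set: set T])%cardinal.
Proof.
apply/ltcNge; rewrite /lec /= => /card_leP/unsquash f.
pose g (B : set T) : T := val (f (SigSub (mem_set (I : [set: set T] B)))).
have ginj B C : g B = g C -> B = C.
  by move=> /val_inj /('inj_f); rewrite !inE => /(_ I I) [].
pose D := [set x | exists2 B, x = g B & ~ B x].
have [DgD|nDgD] := pselect (D (g D)); last by apply: (nDgD); exists D.
by have [B /ginj DB nB] := DgD; apply: nB; rewrite -DB.
Qed.

Lemma succ_cardP T (A : set T) :
  (Card A <c succ_card A)%cardinal /\
  forall k, (Card A <c k)%cardinal -> (succ_card A <=c k)%cardinal.
Proof.
have [|ltA minA] := @of_min_cardP _ [set B : set (set T) | (Card A <c Card B)%cardinal].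
  by exists setT; exact: cantor.
split=> // -[U B] AB; rewrite /lec /=.
have [TB|] := card_le_total [set: set T] B.
  by apply: card_le_trans TB; exact: card_leT.
move=> /pcard_leP/unsquash f.
have fB : f @` B #= B by apply: inj_card_eq => x y xB yB; exact: inj.
apply: (@card_le_trans _ _ _ (f @` B)); last by rewrite (card_le_eql fB) card_lexx.
apply: minA => /=; move: AB; rewrite /ltc /lec /eqc /=.
by rewrite (card_le_eqr fB) (card_eqr fB).
Qed.

Lemma unbounded_nonempty : unbounded !=set0.
Proof.
exists setT => -[g /(_ (fun n => (g n).+1) I)[N /(_ N (leqnn N))]].
by rewrite ltnn.
Qed.

End CardinalFacts.

(* Main.v *)
Require Import Defs.
From mathcomp Require Import all_boot.
From mathcomp Require Import boolp classical_sets functions cardinality.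

(** The witness is the Fubini product I = Fin ⊗ J on [nat * nat]: the sets almost
    all of whose columns lie in J.
    - The columns themselves belong to I, and a set meeting every column in a
      finite set is in I, so I is not a weak P-ideal.
    - A family of at most 𝔟 sequences of finite sets restricts to each column k,
      where 𝔟 < 𝔟(J,Fin,Fin) yields a good finite-to-one index a_k; the index
      (k, j) |-> max(k, a_k(j)) is finite-to-one on [nat * nat] and differs from
      a_k at finitely many points of column k, so it is good for I.
    - For f increasing let E^f_i be the union of the columns k with
      f(i-1) < k <= f(i). If A is a partition into sets of I and g(n) bounds the
      columns of A_0, ..., A_n that are not in J, then A being good for E^f forces
      f <= g almost everywhere; hence 𝔟(I,I,I) <= 𝔟. Conversely, if g eventually
      dominates the analogous bounds for every E in a family, the blocks of
      columns cut out by g form a good partition for that family. *)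

Set Implicit Arguments.
Unset Strict Implicit.
Unset Printing Implicit Defensive.

Local Open Scope classical_set_scope.
Local Open Scope card_scope.

Lemma lec_trans (l k m : cardinal) :
  (k <=c l)%cardinal -> (l <=c m)%cardinal -> (k <=c m)%cardinal.
Proof. exact: card_le_trans. Qed.

Lemma lec_image T U (f : T -> U) (A : set T) :
  (Card (f @` A) <=c Card A)%cardinal.
Proof. exact: card_image_le. Qed.

(** * Partitions as fibres of an index function *)

Section Indexing.
Variable X : Type.
Implicit Types (I J K : set (set X)) (a : X -> nat) (E : nat -> set X).

(* If A_n is the fibre of [a] over n, this is the set U_n (A_n ∩ U_(i <= n) E_i)
   in the definition of [b_witness]. *)
Definition below a E : set X := [set x | exists2 i, i <= a x & E i x].

Lemma bigcup_fibreE a E :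
  \bigcup_n ((a @^-1` [set n]) `&` \bigcup_(i in [set i | i <= n]) E i) =
  below a E.
Proof.
apply/seteqP; split => [x [n _ [/= <- [i /= ia Ei]]]|x [i ia Ei]].
  by exists i.
by exists (a x) => //; split => //; exists i.
Qed.

(** Covering and disjointness give every point exactly one index, so a partition can be traded for
    its index function. *)
Lemma PpartP K (A : nat -> set X) :
  Ppart K A <->
  exists2 a, (forall n, K (a @^-1` [set n])) & A = fun n => a @^-1` [set n].
Proof.
split=> [[[KA tA] cA]|[a Ka ->]].
  have /choice[a aP] : forall x, exists n, A n x.
    by move=> x; have [n _ Anx] : (\bigcup_n A n) x by [rewrite cA]; exists n.
  have eA : A = fun n => a @^-1` [set n].
    apply/funext => n; apply/seteqP; split => [x Anx|x /= <-//].
    by apply: (tA (a x) n I I); exists x; split.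
  by exists a => // n; move: (KA n); rewrite eA.
split; last by apply/seteqP; split => // x _; exists (a x).
split=> // m n _ _ [x [/= <- <-]]; exact: erefl.
Qed.

Lemma b_witnessP I J K (F : set (nat -> set X)) :
  b_witness I J K F <->
  F `<=` Phat K /\
  forall a, (forall n, J (a @^-1` [set n])) -> exists2 E, F E & ~ I (below a E).
Proof.
split=> -[FK FP]; split=> //.
  move=> a Ja; have /FP[E FE] : Ppart J (fun n => a @^-1` [set n]).
    by apply/PpartP; exists a.
  by rewrite bigcup_fibreE; exists E.
move=> A /PpartP[a /FP[E FE nIE] ->]; exists E => //.
by rewrite bigcup_fibreE.
Qed.

Lemma lec_b_ideal_witness I J K (F : set (nat -> set X)) :
  b_witness I J K F -> (b_ideal I J K <=c Card F)%cardinal.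
Proof.
move=> wF; have w0 : b_witness I J K !=set0 by exists F.
rewrite /b_ideal asboolT//; have [_] := of_min_cardP w0; exact.
Qed.

Lemma b_ideal_attained I J K : b_witness I J K !=set0 ->
  exists2 F, b_witness I J K F & b_ideal I J K = Card F.
Proof.
move=> w0; rewrite /b_ideal asboolT//.
by have [wF _] := of_min_cardP w0; exists (card_rep (min_card (b_witness I J K))).
Qed.

(** The first hypothesis settles the case without witnesses, where the value is 𝔠⁺; otherwise the
    minimum is attained. *)
Lemma ltc_b_ideal (k : cardinal) I J K :
  (k <c continuum_succ)%cardinal ->
  (forall F, b_witness I J K F -> ~ (Card F <=c k)%cardinal) ->
  (k <c b_ideal I J K)%cardinal.
Proof.
move=> kc small; have [w0|w0] := pselect (b_witness I J K !=set0).
  by have [F wF ->] := b_ideal_attained w0; apply/ltcNge/small.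
by rewrite /b_ideal asboolF.
Qed.

Lemma ideal_bigcup_le I E n : ideal I -> (forall i, i <= n -> I (E i)) ->
  I (\bigcup_(i in [set i | i <= n]) E i).
Proof.
move=> idI; elim: n => [|n IHn] IE.
  apply: (ideal_subset idI) (IE 0 isT) => x [i /=].
  by rewrite leqn0 => /eqP ->.
have := ideal_setU idI (IHn (fun i le_in => IE i (leqW le_in))) (IE _ (leqnn _)).
apply: (ideal_subset idI) => x [i /=].
rewrite leq_eqVlt => /orP[/eqP->|le_in] Ei; first by right.
by left; exists i.
Qed.

End Indexing.

(** * The bounding number and increasing functions *)

Lemma bounding_number_lt_continuum_succ :
  (bounding_number <c continuum_succ)%cardinal.
Proof.
have [lt_c _] := succ_cardP [set: set nat].
apply/ltcNge => le_b; move/ltcNge: lt_c; apply.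
apply: lec_trans le_b _.
(* Coding graphs as sets of naturals is injective, so every family of functions, in particular a
   minimal unbounded one, has size at most 𝔠. *)
pose graph (f : nat -> nat) := [set pickle (n, f n) | n in [set: nat]].
have graph_inj : injective graph.
  move=> f g fg; apply/funext => n.
  have [m _ /(pcan_inj pickleK)[-> ->]//] : graph g (pickle (n, f n)).
  by rewrite -fg; exists n.
rewrite /lec /=; set B := xget _ _.
have /card_le_eql <- : graph @` B #= B by apply: inj_card_eq => f g _ _ /graph_inj.
exact: subset_card_le.
Qed.

(** Replaces an arbitrary f by a larger function; the successor in each summand makes it strictly
    increasing even where f vanishes. *)
Definition majorant (f : nat -> nat) n := \sum_(i < n.+1) (f i).+1.

Lemma majorantS f n : majorant f n.+1 = majorant f n + (f n.+1).+1.
Proof. by rewrite /majorant big_ord_recr. Qed.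

Lemma majorant_gt f i n : i <= n -> f i < majorant f n.
Proof.
move=> le_in; rewrite /majorant (bigD1 (Ordinal (le_in : i < n.+1))) //=.
exact: leq_addr.
Qed.

Lemma majorant_ltS f n : majorant f n < majorant f n.+1.
Proof. by rewrite majorantS addnS ltnS leq_addr. Qed.

Lemma majorant_ge_id f n : n <= majorant f n.
Proof. by elim: n => // n IHn; exact: leq_ltn_trans IHn (majorant_ltS f n). Qed.

Lemma ex_majorant f k : exists i, k <= majorant f i.
Proof. by exists k; exact: majorant_ge_id. Qed.

(* The i with majorant f (i - 1) < k <= majorant f i. *)
Definition block f k := ex_minn (ex_majorant f k).

Lemma le_majorant_block f k : k <= majorant f (block f k).
Proof. by rewrite /block; case: ex_minnP. Qed.

Lemma block_le f k i : k <= majorant f i -> block f k <= i.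
Proof. by rewrite /block; case: ex_minnP => m _; apply. Qed.

Lemma lt_block f k i : i < block f k -> majorant f i < k.
Proof. by rewrite !ltnNge; apply/contra/block_le. Qed.

Lemma leq_majorant f : {homo majorant f : m n / m <= n}.
Proof.
by apply: homo_leq => [//|? ? ?|n]; [exact: leq_trans|exact/ltnW/majorant_ltS].
Qed.

(** * The Fubini product Fin ⊗ J *)

Section FubiniProduct.
Variable J : set (set nat).
Hypothesis idJ : ideal J.

Definition column k (A : set (nat * nat)) : set nat := [set j | A (k, j)].

Definition fubini_fin : set (set (nat * nat)) :=
  [set A | exists N, forall k, N <= k -> J (column k A)].

Local Notation FJ := fubini_fin.

Lemma finite_column k A : finite_set A -> finite_set (column k A).
Proof.
by move=> finA; apply: (finite_preimage (f := pair k)) => // i j _ _ [].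
Qed.

Lemma finite_columns_fubini_fin A :
  (forall k, finite_set (column k A)) -> FJ A.
Proof. by move=> finA; exists 0 => k _; exact: ideal_finite. Qed.

Lemma first_columns_fubini_fin (A : set (nat * nat)) n :
  (forall x, A x -> x.1 <= n) -> FJ A.
Proof.
move=> An; exists n.+1 => k ltnk; suff -> : column k A = set0.
  by apply: ideal_finite.
by apply/seteqP; split => // j /An /=; rewrite leqNgt ltnk.
Qed.

Lemma ideal_fubini_fin : ideal FJ.
Proof.
split.
- exact: card_nat2.
- move=> A B [N JA] [M JB]; exists (maxn N M) => k.
  by rewrite geq_max => /andP[/JA ? /JB ?]; apply: ideal_setU.
- move=> A B AB [N JB]; exists N => k /JB; apply: ideal_subset => // j; exact: AB.
- move=> A finA; apply: finite_columns_fubini_fin => k; exact: finite_column.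
- by move=> [N /(_ N (leqnn N))]; exact: ideal_setT.
Qed.

Lemma fubini_fin_not_weak_P : ~ weak_P_ideal FJ.
Proof.
pose col k : set (nat * nat) := [set x | x.1 = k].
move=> /(_ (range col)) [| |B nB finB].
- exact: card_image_le.
- by move=> _ [k _ <-]; apply: (@first_columns_fubini_fin _ k) => x ->.
apply: nB; apply: finite_columns_fubini_fin => k.
have /(finite_column k) : finite_set (col k `&` B) by apply: finB; exists k.
by apply: sub_finite_set => j Bj; split.
Qed.

Definition col_thresholds (E : nat -> set (nat * nat)) (g : nat -> nat) :=
  forall i k, g i <= k -> J (column k (E i)).

Lemma ex_col_thresholds E : (forall i, FJ (E i)) -> exists g, col_thresholds E g.
Proof. by move=> /choice[g gP]; exists g. Qed.

Lemma b_fubini_fin_le : (b_ideal FJ FJ FJ <=c bounding_number)%cardinal.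
Proof.
pose blocks f i : set (nat * nat) := [set x | block f x.1 = i].
have [ubB _] := of_min_cardP unbounded_nonempty.
set B := card_rep _ in ubB.
apply: (@lec_trans (Card (blocks @` B))); last exact: lec_image.
apply: lec_b_ideal_witness; apply/b_witnessP; split.
  move=> _ [f _ <-]; split=> [i|i j _ _ [x [/= <- <-]]//].
  by apply: (@first_columns_fubini_fin _ (majorant f i)) => x <-; exact: le_majorant_block.
(* If [a] were good for all block sequences, [majorant g] would eventually dominate all of [B]. *)
move=> a /ex_col_thresholds[g gP]; apply: contrapT => bad.
apply: ubB; exists (majorant g) => f Bf.
have [N JN] : FJ (below a (blocks f)).
  by apply: contrapT => nF; apply: bad; exists (blocks f) => //; exists f.
exists N => i Ni; rewrite leqNgt; apply/negP => lt_gf.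
(* The first column after block i: on it the fibres a <= i are small because
   majorant g i <= k, and the rest is small because A is good for the blocks. *)
pose k := (majorant f i).+1.
have lt_fk : f i < k by apply: leqW; exact: majorant_gt.
have le_Nk : N <= k by apply: leqW; exact: leq_trans Ni (majorant_ge_id f i).
have le_ki : block f k <= i.+1 by apply: block_le; exact: majorant_ltS.
have small : J (\bigcup_(m in [set m | m <= i]) column k (a @^-1` [set m])).
  apply: ideal_bigcup_le => // m le_mi; apply: gP.
  by apply: leq_trans (ltnW (majorant_gt g le_mi)) _; apply: ltnW (ltn_trans lt_gf lt_fk).
apply: (ideal_setT idJ).
apply: (ideal_subset idJ) (ideal_setU idJ small (JN k le_Nk)) => j _.
have [le_ai|lt_ia] := leqP (a (k, j)) i; first by left; exists (a (k, j)).
by right; exists (block f k) => //; exact: leq_trans le_ki lt_ia.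
Qed.

Lemma bounding_number_le_b_fubini_fin :
  (bounding_number <=c b_ideal FJ FJ FJ)%cardinal.
Proof.
have [w0|w0] := pselect (b_witness FJ FJ FJ !=set0); last first.
  rewrite /b_ideal asboolF//.
  by have := bounding_number_lt_continuum_succ; rewrite /ltc => /andP[].
have [F /b_witnessP[FK FP] ->] := b_ideal_attained w0.
have /choice[th thP] : forall E, exists g, F E -> col_thresholds E g.
  move=> E; have [FE|nFE] := pselect (F E); last by exists id.
  by have [/ex_col_thresholds[g gP] _] := FK _ FE; exists g.
apply: lec_trans (lec_image th F).
have [_ minB] := of_min_cardP unbounded_nonempty.
(* The thresholds of members of [F] form an unbounded family: a bound [g] would give an index good
   for all of [F]. *)
apply: minB => -[g gP].
(* The predecessor ensures that, past block 0, a column of index i lies beyond [majorant g i], hence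
   beyond [g 0], ..., [g i]. *)
have [|E FE] := FP (fun x => (block g x.1).-1).
  move=> n; apply: (@first_columns_fubini_fin _ (majorant g n.+1)) => x /= xn.
  apply: leq_trans (le_majorant_block g x.1) _; apply: leq_majorant.
  by rewrite -xn leqSpred.
apply; have [N leN] := gP _ (ex_intro2 _ _ E FE erefl).
(* The first summand handles the i <= N, where [g] need not dominate; the second keeps column k out
   of block 0. *)
exists (majorant (th E) N + (majorant g 0).+1) => k le_k.
apply: (ideal_subset idJ)
  (@ideal_bigcup_le _ J (fun i => column k (E i)) (block g k).-1 idJ _).
  by move=> j [i le_i Ei]; exists i.
move=> i le_i; apply: thP => //.
have [le_iN|/ltnW lt_Ni] := leqP i N.
  apply: leq_trans (ltnW (majorant_gt _ le_iN)) _.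
  exact: leq_trans (leq_addr _ _) le_k.
apply: leq_trans (leN _ lt_Ni) _.
apply: leq_trans (ltnW (majorant_gt g (leqnn i))) _.
apply/ltnW/lt_block.
have block_gt0 : 0 < block g k.
  rewrite lt0n; apply/eqP => b0; have := le_majorant_block g k.
  by rewrite b0 leqNgt (leq_trans (leq_addl _ _) le_k).
by rewrite -(prednK block_gt0) ltnS.
Qed.

Lemma bounding_number_lt_b_fubini_fin :
  (bounding_number <c b_ideal J Fin Fin)%cardinal ->
  (bounding_number <c b_ideal FJ Fin Fin)%cardinal.
Proof.
move=> ltJ; apply: ltc_b_ideal; first exact: bounding_number_lt_continuum_succ.
move=> F /b_witnessP[FK FP] leF.
have /choice[a aP] : forall k, exists a : nat -> nat,
    (forall n, finite_set (a @^-1` [set n])) /\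
    forall E, F E -> J (below a (fun i => column k (E i))).
  move=> k; apply: contrapT => noa.
  (* Without such an index, the restrictions of [F] to column k would witness that 𝔟(J,Fin,Fin) <=
     𝔟. *)
  pose Fk := (fun E : nat -> set (nat * nat) => fun i => column k (E i)) @` F.
  move/ltcNge: ltJ; apply; apply: (@lec_trans (Card Fk)); last first.
    exact: lec_trans (lec_image _ _) leF.
  apply: lec_b_ideal_witness; apply/b_witnessP; split.
    move=> _ [E FE <-]; have [finE tE] := FK _ FE; split=> [i|i j _ _].
      exact: finite_column (finE i).
    by move=> [m [/= Eim Ejm]]; apply: (tE i j I I); exists (k, m).
  move=> a fina; apply: contrapT => bad; apply: noa; exists a; split=> // E FE.
  by apply: contrapT => nJ; apply: bad; exists (fun i => column k (E i)) => //; exists E.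
(* Taking the maximum with the column number confines the fibre over n to columns 0, ..., n, each
   meeting it in a finite set. *)
have [|E FE] := FP (fun x => maxn x.1 (a x.1 x.2)).
  move=> n; have : finite_set
    (\bigcup_(k in `I_n.+1) (pair k @` \bigcup_(m in `I_n.+1) (a k @^-1` [set m]))).
    apply: bigcup_finite => // k _; apply: finite_image.
    by apply: bigcup_finite => // m _; have [] := aP k.
  apply: sub_finite_set => -[k j] /= max_n.
  exists k; first by rewrite /= ltnS -max_n leq_maxl.
  exists j => //; exists (a k j) => //=; by rewrite ltnS -max_n leq_maxr.
apply; exists 0 => k _.
have [fina /(_ _ FE) Ja] := aP k.
(* The maximum can change the index only where [a k j] < k; these finitely many points are absorbed
   by J. *)
have small : J (\bigcup_(m in [set m | m <= k]) (a k @^-1` [set m])).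
  by apply: ideal_bigcup_le => // m _; exact: ideal_finite.
apply: (ideal_subset idJ) (ideal_setU idJ small Ja) => j [i /= le_i Ei].
have [le_ak|lt_ka] := leqP (a k j) k; first by left; exists (a k j).
by right; exists i => //; rewrite -(maxn_idPr (ltnW lt_ka)).
Qed.

End FubiniProduct.

Theorem theorem8p6 :
  (exists J : set (set nat),
      ideal J /\ (bounding_number <c b_ideal J Fin Fin)%cardinal) ->
  exists (X : Type) (I : set (set X)),
    [/\ ideal I,
        ~ weak_P_ideal I,
        (b_ideal I I I =c bounding_number)%cardinal
      & (bounding_number <c b_ideal I Fin Fin)%cardinal].
Proof.
move=> [J [idJ ltJ]]; exists (nat * nat)%type, (fubini_fin J); split.
- exact: ideal_fubini_fin.
- exact: fubini_fin_not_weak_P.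
- rewrite /eqc card_eq_le; apply/andP; split.
    exact: b_fubini_fin_le.
  exact: bounding_number_le_b_fubini_fin.
- exact: bounding_number_lt_b_fubini_fin.
Qed.
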